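(* Let $T\in(0,\infty]$, let $V:(0,T)\times\mathbb{R}\to\mathbb{C}$ be measurable, and let $G:(0,T)\times\mathbb{R}\times\mathbb{R}\to\mathbb{C}$ satisfy the Green's function assumption (stated in the context) with parameters $\alpha\geq 0$, $n\in\mathbb{N}$, $n>\alpha+3$. Let $0\leq\beta<n-\alpha-3$ and assume that $F\in C^n(\mathbb{R},r^\beta)$ and the sequence $(F_m)_m$ in $C^n(\mathbb{R},r^\beta)$ are such that $$\lim_{m\to\infty}\Vert F-F_m\Vert_{C^n(\mathbb{R},r^\beta)}=0.$$ For $H\in C^n(\mathbb{R},r^\beta)$ let $$\Psi(t,x;H):=\lim_{\varepsilon\to 0^+}\int_\mathbb{R}e^{-\varepsilon y^2}G(t,x,y)H(y)\,dy,\qquad t\in(0,T),\,x\in\mathbb{R},$$ be the corresponding solution of the Schrödinger equation $i\frac{\partial}{\partial t}\Psi=\big(-\frac{\partial^2}{\partial x^2}+V\big)\Psi$ with initial condition $H$ (this limit exists). Then $$\lim_{m\to\infty}\Psi(t,x;F_m)=\Psi(t,x;F),$$ where the convergence is locally uniform on $(0,T)\times\mathbb{R}$.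
   Context: All functions are complex-valued. For an open interval $I\subseteq\mathbb{R}$, $\operatorname{AC}(I)$ denotes the functions $f:I\to\mathbb{C}$ for which there is $g\in L^1_{\mathrm{loc}}(I)$ with $f(s_2)-f(s_1)=\int_{s_1}^{s_2}g(s)\,ds$ for all $s_1<s_2$ in $I$ (then $f'=g$ almost everywhere). $\operatorname{AC}_{1,2}((0,T)\times\mathbb{R})$ is the set of $\Psi:(0,T)\times\mathbb{R}\to\mathbb{C}$ such that $\Psi(\cdot,x)\in\operatorname{AC}((0,T))$ for all $x\in\mathbb{R}$ and $\Psi(t,\cdot),\frac{\partial\Psi}{\partial x}(t,\cdot)\in\operatorname{AC}(\mathbb{R})$ for all $t\in(0,T)$. With $r(y):=1+|y|$, for $n\in\mathbb{N}_0$ and $\alpha\ge 0$ let $C^n(\mathbb{R},r^\alpha)$ be the space of $f\in C^n(\mathbb{R})$ for which there is $M\geq 0$ with $|f^{(k)}(y)|\leq Mr(y)^\alpha$ for all $y\in\mathbb{R}$, $k\in\{0,\dots,n\}$, with norm $\Vert f\Vert_{C^n(\mathbb{R},r^\alpha)}:=\max_{k\in\{0,\dots,n\}}\sup_{y\in\mathbb{R}}\frac{|f^{(k)}(y)|}{r(y)^\alpha}$. Green's function assumption (for $G:(0,T)\times\mathbb{R}\times\mathbb{R}\to\mathbb{C}$, with parameters $\alpha\geq 0$, $n\in\mathbb{N}$, $n>\alpha+3$): (i) For every $y\in\mathbb{R}$ the function $G(\cdot,\cdot,y)\in\operatorname{AC}_{1,2}((0,T)\times\mathbb{R})$ is a solution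 of $i\frac{\partial}{\partial t}G(t,x,y)=\big(-\frac{\partial^2}{\partial x^2}+V(t,x)\big)G(t,x,y)$ for almost every $t\in(0,T)$, $x\in\mathbb{R}$. (ii) For every $x_0>0$ and $\varphi\in C^1([-x_0,x_0])$ one has $\lim_{t\to 0^+}\int_{-x_0}^{x_0}G(t,x,y)\varphi(y)\,dy=\varphi(x)$ for all $x\in(-x_0,x_0)$. (iii) For some $a\in\operatorname{AC}((0,T))$ with $a(t)>0$ for $t\in(0,T)$ and $\lim_{t\to 0^+}a(t)=\infty$ one has $G(t,x,y)=e^{ia(t)(y-x)^2}\widetilde{G}(t,x,y)$ for $t\in(0,T)$, $x,y\in\mathbb{R}$, with a function $\widetilde{G}$ satisfying $\widetilde{G}(t,x,\cdot)\in C^n(\mathbb{R},r^\alpha)$, $\widetilde{G}_x(t,x,\cdot)\in C^n(\mathbb{R},r^{\alpha+1})$, and $\widetilde{G}_{xx}(t,x,\cdot),\widetilde{G}_t(t,x,\cdot)\in C^n(\mathbb{R},r^{\alpha+2})$ (subscripts denote partial derivatives). Moreover, the norms $\Vert\widetilde{G}(t,x,\cdot)\Vert_{C^n(\mathbb{R},r^\alpha)}$, $\Vert\widetilde{G}_x(t,x,\cdot)\Vert_{C^n(\mathbb{R},r^{\alpha+1})}$, $\Vert\widetilde{G}_{xx}(t,x,\cdot)\Vert_{C^n(\mathbb{R},r^{\alpha+2})}$, $\Vert\widetilde{G}_t(t,x,\cdot)\Vert_{C^n(\mathbb{R},r^{\alpha+2})}$ are locally bounded on $(0,T)\times\mathbb{R}$,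 and $\lim_{t\to 0^+}\frac{\Vert\widetilde{G}(t,x,\cdot)\Vert_{C^n(\mathbb{R},r^\alpha)}}{a(t)}=0$ for every $x\in\mathbb{R}$. *)

(* Defs.v *)
From HB Require Import structures.
From mathcomp Require Import all_boot all_order all_algebra.
From mathcomp Require Import all_classical all_reals all_analysis.
From mathcomp.real_closed Require Export complex.
Export numFieldNormedType.Exports.

Set Implicit Arguments.
Unset Strict Implicit.
Unset Printing Implicit Defensive.

Import Order.TTheory GRing.Theory Num.Theory.
Import ComplexField.

Local Open Scope classical_set_scope.
Local Open Scope ring_scope.
Local Open Scope complex_scope.

(* not the operators Num.Re and Num.Im, which return elements of R[i] *)
Local Notation Re := complex.Re.
Local Notation Im := complex.Im.

Section ComplexValued.
Context {R : realType}.
Implicit Types (f : R -> R[i]) (I : set R).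

(* R[i] with the topology and uniformity of its modulus; giving it the type
   numFieldType is what makes the library find these structures. *)
Definition Cfield : numFieldType := R[i].

Definition cis (theta : R) : R[i] := cos theta +i* sin theta.

Definition Cintegral I f : R[i] :=
  (\int[lebesgue_measure]_(s in I) Re (f s))
    +i* (\int[lebesgue_measure]_(s in I) Im (f s)).

Definition is_Cderive f (s : R) (l : R[i]) : Prop :=
  is_derive s 1 (@Re R \o f) (Re l) /\ is_derive s 1 (@Im R \o f) (Im l).

Definition Cderivable f (s : R) : Prop :=
  derivable (@Re R \o f) s 1 /\ derivable (@Im R \o f) s 1.

Definition Cderiven (k : nat) f (s : R) : R[i] :=
  derive1n k (@Re R \o f) s +i* derive1n k (@Im R \o f) s.

Definition Cderive f : R -> R[i] := Cderiven 1 f.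

Definition L1loc I f : Prop :=
  locally_integrable I (@Re R \o f) /\ locally_integrable I (@Im R \o f).

Definition AC I f : Prop :=
  exists2 g : R -> R[i], L1loc I g &
    forall s1 s2, I s1 -> I s2 -> s1 < s2 ->
      f s2 - f s1 = Cintegral `[s1, s2] g.

Definition C1_segment (b c : R) f : Prop :=
  {within `[b, c], continuous (@Re R \o f)} /\
  {within `[b, c], continuous (@Im R \o f)} /\
  exists g : R -> R[i],
    [/\ {within `[b, c], continuous (@Re R \o g)},
        {within `[b, c], continuous (@Im R \o g)} &
        forall s, s \in `]b, c[ -> is_Cderive f s (g s)].

Definition Cn (n : nat) f : Prop :=
  (forall k s, (k < n)%N -> Cderivable (Cderiven k f) s) /\
  (forall k, (k <= n)%N ->
    continuous (@Re R \o Cderiven k f) /\ continuous (@Im R \o Cderiven k f)).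

Definition weight (y : R) : R := 1 + `|y|.

(* f in C^n(R, r^alpha) *)
Definition Cnw (n : nat) (alpha : R) f : Prop :=
  Cn n f /\
  exists2 M : R, 0 <= M &
    forall y k, (k <= n)%N ->
      Normc.normc (Cderiven k f y) <= M * weight y `^ alpha.

Definition Cnw_norm (n : nat) (alpha : R) f : R :=
  \big[Order.max/0]_(k < n.+1)
    sup (range (fun y => Normc.normc (Cderiven k f y) / weight y `^ alpha)).

End ComplexValued.

Section GreenFunction.
Context {R : realType}.
Implicit Types (T : \bar R) (V : R -> R -> R[i]) (G : R -> R -> R -> R[i]).

(* (0, T), where T may be +oo *)
Definition time_interval T : set R := [set t | 0 < t /\ (t%:E < T)%E].

Definition AC12 T (Psi : R -> R -> R[i]) : Prop :=
  (forall x, AC (time_interval T) (Psi^~ x)) /\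
  (forall t, time_interval T t ->
    [/\ AC setT (Psi t), forall x, Cderivable (Psi t) x &
        AC setT (Cderive (Psi t))]).

Definition measurable_potential T V : Prop :=
  measurable_fun (time_interval T `*` setT) (fun p : R * R => Re (V p.1 p.2)) /\
  measurable_fun (time_interval T `*` setT) (fun p : R * R => Im (V p.1 p.2)).

(* The equation includes the existence of the two derivatives it contains. *)
Definition schrodinger_ae T V (Psi : R -> R -> R[i]) : Prop :=
  {ae (@lebesgue_measure R \x @lebesgue_measure R)%E,
    forall p : R * R, time_interval T p.1 ->
      [/\ Cderivable (Psi^~ p.2) p.1,
          Cderivable (Cderive (Psi p.1)) p.2 &
          (0 +i* 1) * Cderive (Psi^~ p.2) p.1 =
          - Cderive (Cderive (Psi p.1)) p.2 + V p.1 p.2 * Psi p.1 p.2]}.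

Definition locally_bounded T (N : R -> R -> R) : Prop :=
  forall t x, time_interval T t ->
    exists M : R, \forall p \near ((t, x) : R * R), N p.1 p.2 <= M.

(* In an AC class a derivative is determined only up to a null set: Gt_t and
   Gt_xx are representatives, defined for all arguments, that agree with the
   pointwise derivatives of Gt and Gt_x almost everywhere in the variable of
   differentiation.  Derivatives existing everywhere are a special case. *)
Definition green_phase T (alpha : R) (n : nat) G : Prop :=
  exists (a : R -> R) (Gt Gt_xx Gt_t : R -> R -> R -> R[i]),
  let Gt_x t x y := Cderive (fun x' => Gt t x' y) x in
  [/\ AC (time_interval T) (fun t => (a t)%:C),
      forall t, time_interval T t -> 0 < a t &
      a t @[t --> 0^'+] --> +oo] /\
  (forall t x y, time_interval T t -> G t x y = cis (a t * (y - x) ^+ 2) * Gt t x y) /\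
  [/\ forall t x y, time_interval T t -> Cderivable (fun x' => Gt t x' y) x,
      forall t y, time_interval T t ->
        {ae lebesgue_measure, forall x : R,
          is_Cderive (fun x' => Gt_x t x' y) x (Gt_xx t x y)} &
      forall x y,
        {ae lebesgue_measure, forall t : R, time_interval T t ->
          is_Cderive (fun t' => Gt t' x y) t (Gt_t t x y)}] /\
  (forall t x, time_interval T t ->
    [/\ Cnw n alpha (Gt t x), Cnw n (alpha + 1) (Gt_x t x),
        Cnw n (alpha + 2) (Gt_xx t x) & Cnw n (alpha + 2) (Gt_t t x)]) /\
  [/\ locally_bounded T (fun t x => Cnw_norm n alpha (Gt t x)),
      locally_bounded T (fun t x => Cnw_norm n (alpha + 1) (Gt_x t x)),
      locally_bounded T (fun t x => Cnw_norm n (alpha + 2) (Gt_xx t x)) &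
      locally_bounded T (fun t x => Cnw_norm n (alpha + 2) (Gt_t t x))] /\
  (forall x, Cnw_norm n alpha (Gt t x) / a t @[t --> 0^'+] --> (0 : R)).

Definition green_initial G : Prop :=
  forall (x0 : R) (phi : R -> R[i]), 0 < x0 -> C1_segment (- x0) x0 phi ->
  forall x, x \in `]- x0, x0[ ->
    ((Cintegral `[- x0, x0] (fun y => G t x y * phi y) : Cfield)
       @[t --> (0 : R)^'+] --> (phi x : Cfield)).

Definition green_assumption T V (alpha : R) (n : nat) G : Prop :=
  [/\ forall y, AC12 T (fun t x => G t x y) /\
        schrodinger_ae T V (fun t x => G t x y),
      green_initial G &
      green_phase T alpha n G].

Definition regularized G (H : R -> R[i]) (t x eps : R) : Cfield :=
  Cintegral setT (fun y => (expR (- (eps * y ^+ 2)))%:C * G t x y * H y).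

(* lim has an arbitrary value where the limit does not exist, so statements
   about Psi should come with convergence. *)
Definition Psi G (H : R -> R[i]) (t x : R) : Cfield :=
  lim (regularized G H t x eps @[eps --> (0 : R)^'+]).

End GreenFunction.

(* Main.v *)
Require Import Defs.
From HB Require Import structures.
From mathcomp Require Import all_boot all_order all_algebra.
From mathcomp Require Import all_classical all_reals all_analysis.
From mathcomp Require Import measurable_realfun ring lra.

Import Order.TTheory GRing.Theory Num.Theory.
Local Open Scope classical_set_scope.
Local Open Scope ring_scope.

Set Implicit Arguments.
Unset Strict Implicit.
Unset Printing Implicit Defensive.

(** Since G = exp (i a(t) (y - x)^2) Gt for t in (0, T), the solution
    Psi(t, x; H) is the limit of oscillatory integrals of the amplitude
    h = Gt(t, x, .) H against a quadratic phase, damped by exp (- eps y^2).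
    The amplitude has n derivatives, all of which grow at most like
    (1 + |y|)^(alpha + beta), with a constant proportional to the product of
    the norm of Gt(t, x, .) and the norm of H.

    The core is a bound for such integrals that does not see the damping
    ([oscillation_line]).  The identity
      exp (i a z^2) = exp (i a z^2) / (1 + z^2)
                      + (z / (1 + z^2)) (d/dz exp (i a z^2)) / (2 i a)
    and an integration by parts replace the amplitude by one that has one
    derivative less and decays one order faster ([oscillation_parts]).  After
    n steps the growth alpha + beta, even increased by one, is turned into a
    decay of order at least 2, because alpha + beta < n - 3.  The constant
    depends only on n, a positive lower bound for a(t) and an upper bound for
    |x|.

    The derivatives of the regularizer exp (- eps y^2) are bounded uniformly
    in eps <= 1, and its distance to 1 is of order sqrt eps if one more order
    of growth is allowed ([gauss_derivs_le], [gauss_sub1_derivs_le]).  Applied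
    to the difference of two regularizers, the core bound is a Cauchy criterion
    that gives the existence of the limit; applied to one regularizer, it gives
    an estimate that passes to the limit.  Both are in [damped_bound].

    Since Psi(t, x; F) - Psi(t, x; F_m) is the limit for the initial condition
    F - F_m, it is at most C times the norm of Gt(t, x, .) times the norm of
    F - F_m ([damped_solution_lipschitz]).  The function a is continuous and
    positive, hence bounded below near any t, and the norm of Gt(t, x, .) is
    locally bounded: the constant is locally uniform, and so is the
    convergence.

    Everything is done with real functions: the cosine with a phase shift
    theta stands for both components of the exponential, so that the calculus
    of derivatives and integrals of real functions applies. *)

(** * Functions with bounded derivatives *)

Section DerivativeBounds.
Context {R : realType}.
Implicit Types (B h f g : R -> R) (N : nat).

(** The bound is a function of the point, the same one for all derivatives of
    order at most N, and the derivatives are existentially quantified.  This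
    form is stable under products (with an exponential loss in N only) and
    makes each integration by parts one step of an induction on N. *)
Fixpoint derivs_le N B h : Prop :=
  (forall y, `|h y| <= B y) /\
  match N with
  | 0 => continuous h
  | N'.+1 => exists2 h' : R -> R, (forall y : R, is_derive y 1 h (h' y)) & derivs_le N' B h'
  end.

Lemma is_derive_continuous f (f' : R -> R) :
  (forall y : R, is_derive y 1 f (f' y)) -> continuous f.
Proof.
move=> df y; apply: differentiable_continuous.
by apply/derivable1_diffP; have [] := df y.
Qed.

Lemma derivs_le_bound N B h : derivs_le N B h -> forall y, `|h y| <= B y.
Proof. by case: N => [|N] []. Qed.

Lemma derivs_leS N B h : derivs_le N.+1 B h ->
  exists2 h' : R -> R, (forall y : R, is_derive y 1 h (h' y)) & derivs_le N B h'.
Proof. by case. Qed.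

Lemma derivs_le_continuous N B h : derivs_le N B h -> continuous h.
Proof. by case: N => [|N] [] // _ [h' dh _]; exact: is_derive_continuous dh. Qed.

Lemma derivs_leW N B h : derivs_le N.+1 B h -> derivs_le N B h.
Proof.
elim: N h => [|N IH] h /= [hB [h' dh h'B]]; split=> //.
  exact: is_derive_continuous dh.
by exists h' => //; exact: IH.
Qed.

Lemma derivs_le_mono N B1 B2 h : (forall y, B1 y <= B2 y) ->
  derivs_le N B1 h -> derivs_le N B2 h.
Proof.
move=> B12; elim: N h => [|N IH] h /= [hB hD]; split=> //.
- by move=> y; exact: le_trans (B12 y).
- by move=> y; exact: le_trans (B12 y).
- by case: hD => h' dh h'B; exists h' => //; exact: IH.
Qed.

Lemma derivs_leD N B1 B2 f g : derivs_le N B1 f -> derivs_le N B2 g ->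
  derivs_le N (fun y => B1 y + B2 y) (fun y => f y + g y).
Proof.
elim: N f g => [|N IH] f g /= [fB fD] [gB gD]; split.
- by move=> y; rewrite (le_trans (ler_normD _ _))// lerD.
- by move=> y; apply: cvgD; [exact: fD|exact: gD].
- by move=> y; rewrite (le_trans (ler_normD _ _))// lerD.
- case: fD => f' df f'B; case: gD => g' dg g'B.
  by exists (fun y => f' y + g' y); [move=> y; exact: is_deriveD|exact: IH].
Qed.

Lemma derivs_leZ N (c : R) B f : derivs_le N B f ->
  derivs_le N (fun y => `|c| * B y) (fun y => c * f y).
Proof.
elim: N f => [|N IH] f /= [fB fD]; split.
- by move=> y; rewrite normrM ler_wpM2l.
- by move=> y; apply: cvgMr; exact: fD.
- by move=> y; rewrite normrM ler_wpM2l.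
- case: fD => f' df f'B.
  by exists (fun y => c * f' y); [move=> y; exact: is_deriveZ|exact: IH].
Qed.

Lemma derivs_leM N B1 B2 f g : derivs_le N B1 f -> derivs_le N B2 g ->
  derivs_le N (fun y => 2 ^+ N * (B1 y * B2 y)) (fun y => f y * g y).
Proof.
elim: N f g => [|N IH] f g.
  move=> /= [fB fD] [gB gD]; split=> y.
    by rewrite expr0 mul1r normrM ler_pM.
  by apply: cvgM; [exact: fD|exact: gD].
move=> Df Dg; have [fB [f' df f'B]] := Df; have [gB [g' dg g'B]] := Dg.
have B12 y : 0 <= B1 y * B2 y.
  by rewrite mulr_ge0// (le_trans (normr_ge0 _) (fB _), le_trans (normr_ge0 _) (gB _)).
split=> [y|].
  rewrite normrM (le_trans (ler_pM _ _ (fB y) (gB y)))// ler_peMl//.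
  by rewrite exprn_ege1// ler1n.
exists (fun y => f y * g' y + g y * f' y).
  by move=> y; exact: is_deriveM.
have := derivs_leD (IH _ _ (derivs_leW Df) g'B)
  (IH _ _ f'B (derivs_leW Dg)).
rewrite [X in derivs_le _ _ X](_ : _ = fun y => f y * g' y + g y * f' y); last first.
  by apply/funext => y; rewrite (mulrC (f' y)).
by apply: derivs_le_mono => y; rewrite exprS -mulrA mulr_natl mulr2n.
Qed.

(** Two bounds for the same function can be combined pointwise because its
    derivatives are unique.  It lets one bound control an integral while the
    other one controls the behaviour at infinity. *)
Lemma derivs_le_min N B1 B2 f : derivs_le N B1 f -> derivs_le N B2 f ->
  derivs_le N (fun y => Num.min (B1 y) (B2 y)) f.
Proof.
elim: N f => [|N IH] f /= [fB fD] [gB gD]; split => //.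
- by move=> y; rewrite le_min fB gB.
- by move=> y; rewrite le_min fB gB.
- case: fD => f' df f'B; case: gD => g' dg g'B.
  exists f' => //; apply: IH => //.
  suff -> : f' = g' by [].
  by apply/funext => y; rewrite -(@derive_val _ _ _ _ _ _ _ (df y)) (@derive_val _ _ _ _ _ _ _ (dg y)).
Qed.

End DerivativeBounds.

(** * Multipliers of order minus one *)

Section Symbols.
Context {R : realType}.
Implicit Types (x y : R).

Definition lorentz x y : R := (oneDsqr (y - x))^-1.
Definition lorentz_odd x y : R := (y - x) * lorentz x y.

Lemma is_derive_lorentz x y : is_derive y 1 (lorentz x) (- 2 * (lorentz x y * lorentz_odd x y)).
Proof.
have n0 : oneDsqr (y - x) != 0 by rewrite gt_eqF// (lt_le_trans _ (oneDsqr_ge1 _)).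
rewrite /lorentz /oneDsqr.
have D : is_derive y 1 (fun y => 1 + (y - x) ^+ 2) (2 * (y - x)).
  apply: is_derive_eq; rewrite /GRing.scale /=; ring.
have := @is_deriveV R (fun y => 1 + (y - x) ^+ 2) _ _ _ n0 D.
set d := (X in is_derive _ _ _ X); suff -> : d = - 2 * (lorentz x y * lorentz_odd x y) by [].
by rewrite /d /lorentz_odd /lorentz /GRing.scale /=; rewrite /oneDsqr in n0 *; field.
Qed.

Lemma is_derive_lorentz_odd x y :
  is_derive y 1 (lorentz_odd x) (lorentz x y - 2 * (lorentz_odd x y * lorentz_odd x y)).
Proof.
have D := is_derive_lorentz x y.
have D1 : is_derive y 1 (fun y => y - x) 1.
  by apply: is_derive_eq; rewrite subr0.
have := is_deriveM D1 D.
set d := (X in is_derive _ _ _ X).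
suff -> : d = lorentz x y - 2 * (lorentz_odd x y * lorentz_odd x y) by [].
by rewrite /d /lorentz_odd /GRing.scale /=; ring.
Qed.

Lemma lorentz_bound x y : `|lorentz x y| <= 2 / (1 + `|y - x|).
Proof.
have p : 0 < 1 + `|y - x| by rewrite ltr_pwDl.
have q : 0 < oneDsqr (y - x) by rewrite (lt_le_trans _ (oneDsqr_ge1 _)).
rewrite /lorentz normfV gtr0_norm// ler_pdivlMr// mulrC ler_pdivrMr//.
rewrite /oneDsqr -(real_normK (num_real (y - x))).
by have := normr_ge0 (y - x); nra.
Qed.

Lemma lorentz_odd_bound x y : `|lorentz_odd x y| <= 2 / (1 + `|y - x|).
Proof.
have p : 0 < 1 + `|y - x| by rewrite ltr_pwDl.
have q : 0 < oneDsqr (y - x) by rewrite (lt_le_trans _ (oneDsqr_ge1 _)).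
rewrite /lorentz_odd /lorentz normrM normfV (gtr0_norm q) ler_pdivlMr// mulrAC ler_pdivrMr//.
rewrite /oneDsqr -[X in 2 * (_ + X)](real_normK (num_real (y - x))).
by have := normr_ge0 (y - x); nra.
Qed.

(** Differentiating does not leave the algebra spanned by the products of the
    two functions, whose derivatives are polynomials of degree 2 in them: an induction on N
    suffices, and the square of a bound C / (1 + |y - x|) is again such a
    bound because 1 + |y - x| is at least 1. *)
Lemma lorentz_derivs_le N : exists2 C : R, 0 <= C & forall x,
  derivs_le N (fun y => C / (1 + `|y - x|)) (lorentz x) /\
  derivs_le N (fun y => C / (1 + `|y - x|)) (lorentz_odd x).
Proof.
elim: N => [|N [C C0 IH]].
  exists 2 => // x; split; split.
  - exact: lorentz_bound.
  - by apply: is_derive_continuous => y; exact: is_derive_lorentz.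
  - exact: lorentz_odd_bound.
  - by apply: is_derive_continuous => y; exact: is_derive_lorentz_odd.
pose P : R := 2 ^+ N * (C * C).
have P0 : 0 <= P by rewrite !mulr_ge0// exprn_ge0.
exists (2 + C + 2 * P) => [|x]; first lra.
have [S0 S1] := IH x.
have r1 y : 1 <= 1 + `|y - x| by rewrite lerDl.
have i0 y : 0 < (1 + `|y - x|)^-1 by rewrite invr_gt0 (lt_le_trans _ (r1 y)).
have i1 y : (1 + `|y - x|)^-1 <= 1 by rewrite invf_le1// (lt_le_trans _ (r1 y)).
have sq_le y : 2 * (2 ^+ N * (C / (1 + `|y - x|) * (C / (1 + `|y - x|)))) <=
    2 * P / (1 + `|y - x|).
  have := i0 y; have := i1 y; set r := _^-1 => r1' r0.
  rewrite (_ : _ * _ = 2 * P * r * r); last by rewrite /P; ring.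
  have Pr : 0 <= 2 * P * r by rewrite !mulr_ge0// ltW.
  exact: ler_piMr Pr r1'.
split; split.
- by move=> y; rewrite (le_trans (lorentz_bound x y))// ler_wpM2r ?(ltW (i0 _))//; lra.
- exists (fun y => - 2 * (lorentz x y * lorentz_odd x y)) => [y|]; first exact: is_derive_lorentz.
  apply: derivs_le_mono (derivs_leZ (-2) (derivs_leM S0 S1)) => y.
  rewrite normrN normr_nat// (le_trans (sq_le y))// ler_wpM2r ?(ltW (i0 _))//.
  by rewrite lerDr; lra.
- by move=> y; rewrite (le_trans (lorentz_odd_bound x y))// ler_wpM2r ?(ltW (i0 _))//; lra.
- exists (fun y => lorentz x y + - 2 * (lorentz_odd x y * lorentz_odd x y)) => [y|].
    by rewrite mulNr; exact: is_derive_lorentz_odd.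
  apply: derivs_le_mono (derivs_leD S0 (derivs_leZ (-2) (derivs_leM S1 S1))) => y.
  rewrite normrN normr_nat//.
  apply: (le_trans (lerD (lexx _) (sq_le y))).
  by rewrite -mulrDl ler_wpM2r ?(ltW (i0 _))// -addrA lerDr.
Qed.

End Symbols.

(** * Integration by parts on a segment *)

Section Oscillation.
Context {R : realType}.
Implicit Types (x y a theta K b A : R) (B h : R -> R).
Notation mu := (@lebesgue_measure R).

(** The shift theta makes one family out of the real and imaginary parts of
    exp (i a (y - x)^2) and their opposites; differentiation and integration
    act on it by a quarter turn. *)
Definition wave a x theta y : R := cos (a * (y - x) ^+ 2 + theta).

Lemma is_derive_wave a x theta y :
  is_derive y 1 (wave a x theta)
    (2 * a * ((y - x) * wave a x (theta + pi / 2) y)).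
Proof.
have D : is_derive y 1 (fun y => a * (y - x) ^+ 2 + theta) (2 * a * (y - x)).
  apply: is_derive_eq; rewrite /GRing.scale /=; ring.
rewrite /wave addrA cosDpihalf.
rewrite (_ : _ * _ = - sin (a * (y - x) ^+ 2 + theta) * (2 * a * (y - x))); last ring.
exact: is_derive1_comp (is_derive_cos _) D.
Qed.

Lemma wave_continuous a x theta : continuous (wave a x theta).
Proof. by apply: is_derive_continuous => y; exact: is_derive_wave. Qed.

Lemma wave_le1 a x theta y : `|wave a x theta y| <= 1.
Proof. by rewrite ler_norml cos_geN1 cos_le1. Qed.

Lemma weight_ge1 y : 1 <= weight y.
Proof. by rewrite lerDl. Qed.

Lemma weight_gt0 y : 0 < weight y.
Proof. by rewrite (lt_le_trans _ (weight_ge1 y)). Qed.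

(** Exchanges decay centred at x for decay centred at 0, at a cost that is
    locally bounded in x. *)
Lemma weight_shift X x y : `|x| <= X -> (1 + `|y - x|)^-1 <= (1 + X) / weight y.
Proof.
move=> xX; have p : 0 < 1 + `|y - x| by rewrite ltr_pwDl.
rewrite ler_pdivlMr ?weight_gt0// mulrC ler_pdivrMr// /weight.
have := ler_normD (y - x) x; rewrite subrK.
by have := normr_ge0 (y - x); have := normr_ge0 x; nra.
Qed.

Lemma integrable_segment A (f : R -> R) : continuous f ->
  mu.-integrable `[- A, A] (EFin \o f).
Proof.
move=> cf; apply: continuous_compact_integrable; first exact: segment_compact.
exact: continuous_subspaceT.
Qed.

Lemma Rintegral_segment_le A K (f : R -> R) : 0 < A -> continuous f ->
  (forall y, `|f y| <= K / oneDsqr y) ->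
  `|\int[mu]_(y in `[- A, A]) f y| <= K * pi.
Proof.
move=> A0 cf fK.
have K0 : 0 <= K.
  have := le_trans (normr_ge0 _) (fK 0).
  by rewrite pmulr_lge0// invr_gt0 (lt_le_trans _ (oneDsqr_ge1 _)).
have ck : continuous (fun y : R => (oneDsqr y)^-1) := @continuous_oneDsqrV R.
apply: (le_trans (le_normr_Rintegral _ _)) => //; first exact: integrable_segment.
apply: (@le_trans _ _ (\int[mu]_(y in `[- A, A]) (K * (oneDsqr y)^-1))).
  apply: le_Rintegral => //.
  - by apply: integrable_segment => y; apply: cvg_norm; exact: cf.
  - by apply: integrable_segment => y; apply: cvgMr; exact: ck.
rewrite RintegralZl//; last exact: integrable_segment.
apply: ler_wpM2l => //.
have AA : - A < A by lra.
rewrite /Rintegral (@continuous_FTC2 _ _ atan)//=.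
- have := @atan_ltpi2 R A; have := @atan_gtNpi2 R (- A); lra.
- exact: continuous_subspaceT.
- split.
  + by move=> x _; exact: derivable_atan.
  + by apply: cvg_at_right_filter; exact: continuous_atan.
  + by apply: cvg_at_left_filter; exact: continuous_atan.
- by move=> x x01; rewrite derive1_atan// mul1r.
Qed.

Lemma derivable_LR (f f' : R -> R) u v : (forall y : R, is_derive y 1 f (f' y)) ->
  derivable_oo_LRcontinuous f u v.
Proof.
move=> df; have cf := is_derive_continuous df; split.
- by move=> x _; have [] := df x.
- by apply: cvg_at_right_filter; exact: cf.
- by apply: cvg_at_left_filter; exact: cf.
Qed.

(** With z = y - x one has 1 = 1 / (1 + z^2) + z * (z / (1 + z^2)), and
    z * wave is, up to the factor 2 a, the derivative of a wave.  The first
    summand of h gains two orders of decay and the second one is integrated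
    by parts, which trades one derivative of h for one order of decay; no
    singularity arises at the stationary point y = x. *)
Lemma oscillation_parts a x theta A h F' : 0 < a -> 0 < A -> continuous h ->
  (forall y : R, is_derive y 1 (fun y => lorentz_odd x y * h y) (F' y)) ->
  continuous F' ->
  \int[mu]_(y in `[- A, A]) (wave a x theta y * h y) =
  \int[mu]_(y in `[- A, A]) (wave a x theta y * (lorentz x y * h y)) +
  (2 * a)^-1 * (lorentz_odd x A * h A * wave a x (theta - pi / 2) A
     - lorentz_odd x (- A) * h (- A) * wave a x (theta - pi / 2) (- A)
     - \int[mu]_(y in `[- A, A]) (wave a x (theta - pi / 2) y * F' y)).
Proof.
move=> a0 A0 ch dF cF'; pose F y := lorentz_odd x y * h y.
have cF : continuous F := is_derive_continuous dF.
have cW t := @wave_continuous a x t.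
have cS0 : continuous (lorentz x).
  by apply: is_derive_continuous => y; exact: is_derive_lorentz.
have cid : continuous (fun y : R => y - x) by move=> y; apply: cvgB => //; exact: cvg_cst.
pose G y := (2 * a)^-1 * wave a x (theta - pi / 2) y.
pose g y := (y - x) * wave a x theta y.
have cg : continuous g by move=> y; apply: cvgM; [exact: cid|exact: cW].
have dG (y : R) : is_derive y 1 G (g y).
  have := @is_deriveZ _ _ _ _ ((2 * a)^-1) _ _ _ (is_derive_wave a x (theta - pi / 2) y).
  rewrite subrK; set d := (X in is_derive _ _ _ X); suff -> : d = g y by [].
  by rewrite /d /g /GRing.scale /=; field; rewrite gt_eqF.
have cS0h : continuous (fun y => wave a x theta y * (lorentz x y * h y)).
  move=> y; apply: cvgM; first exact: cW.
  by apply: cvgM; [exact: cS0|exact: ch].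
have cFg : continuous (fun y => F y * g y).
  by move=> y; apply: cvgM; [exact: cF|exact: cg].
have cF'W : continuous (fun y => wave a x (theta - pi / 2) y * F' y).
  by move=> y; apply: cvgM; [exact: cW|exact: cF'].
under eq_Rintegral => y _.
  have q : oneDsqr (y - x) != 0 by rewrite gt_eqF// (lt_le_trans _ (oneDsqr_ge1 _)).
  rewrite (_ : _ * _ = wave a x theta y * (lorentz x y * h y) + F y * g y); last first.
    by rewrite /F /g /lorentz_odd /lorentz; rewrite /oneDsqr in q *; field.
  over.
rewrite RintegralD//; [|exact: integrable_segment..].
congr (_ + _).
rewrite (@Rintegration_by_parts _ F G F' g)//.
- rewrite mulrBr mulrBr -/(F A) -/(F (- A)) /G !(mulrCA _ (F _)).
  congr (_ - _).
  rewrite -RintegralZl//; last exact: integrable_segment.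
  by apply: eq_Rintegral => y _; ring.
- by rewrite gtrN.
- exact: continuous_subspaceT.
- exact: derivable_LR dF.
- by move=> y _; rewrite derive1E; exact: (@derive_val _ _ _ _ _ _ _ (dF y)).
- exact: continuous_subspaceT.
- exact: derivable_LR dG.
- by move=> y _; rewrite derive1E; exact: (@derive_val _ _ _ _ _ _ _ (dG y)).
Qed.

End Oscillation.

Section OscillationBound.
Context {R : realType}.
Implicit Types (x y a theta K b A : R) (B h : R -> R).
Notation mu := (@lebesgue_measure R).

(** Each integration by parts turns a bound B on N.+1 derivatives into the bound
    D * B / weight on N derivatives, so N of them reduce the weight N-th power
    in the hypothesis on B to an integrable function.  The constant depends on
    a and x only through a lower bound for a and an upper bound for |x|; the
    boundary terms are kept in b. *)
Lemma oscillation_segment N (a0 X : R) : 0 < a0 -> exists2 C : R, 0 <= C &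
  forall a x theta A K b B h, a0 <= a -> `|x| <= X -> 0 < A ->
    derivs_le N B h -> (forall y, B y <= K * (weight y ^+ N / oneDsqr y)) ->
    B A <= b -> B (- A) <= b ->
    `|\int[mu]_(y in `[- A, A]) (wave a x theta y * h y)| <= C * (K + b).
Proof.
move=> a0_gt0; elim: N => [|N [C1 C1_ge0 IH]].
  exists pi; first exact: pi_ge0.
  move=> a x theta A K b B h aa0 xX A0 [hB ch] BK BA _.
  have b0 : 0 <= b by rewrite (le_trans _ BA)// (le_trans _ (hB _)).
  apply: (@le_trans _ _ (K * pi)).
    apply: Rintegral_segment_le => // y.
      by apply: cvgM; [exact: wave_continuous|exact: ch].
    rewrite normrM (le_trans (ler_piMl _ (wave_le1 _ _ _ _)))//.
    by rewrite (le_trans (hB y))// (le_trans (BK y))// expr0 mul1r.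
  by rewrite mulrC ler_wpM2l ?pi_ge0// lerDl.
have [c c0 Hc] := @lorentz_derivs_le R N.+1.
pose D := 2 ^+ N.+1 * c * (1 + `|X|).
have D0 : 0 <= D by rewrite !mulr_ge0// exprn_ge0.
exists (C1 * D + D / a0 + C1 * D / (2 * a0)).
  by rewrite !addr_ge0// !mulr_ge0// invr_ge0 ?mulr_ge0// ltW.
move=> a x theta A K b B h aa0 xX A0 hB BK BA BNA.
have a_gt0 : 0 < a by exact: lt_le_trans aa0.
have B0 y : 0 <= B y by rewrite (le_trans _ (derivs_le_bound hB y)).
have b0 : 0 <= b by rewrite (le_trans _ BA).
have K0 : 0 <= K.
  have := le_trans (B0 0) (BK 0); rewrite pmulr_lge0// divr_gt0//.
  by rewrite exprn_gt0// weight_gt0.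
have [Hc0 Hc1] := Hc x.
pose B' y := D * (B y / weight y).
have step s : derivs_le N.+1 (fun y => c / (1 + `|y - x|)) s ->
    derivs_le N.+1 B' (fun y => s y * h y).
  move=> sc; apply: derivs_le_mono (derivs_leM sc hB) => y.
  rewrite /B' /D -!mulrA; apply: ler_wpM2l; first exact: exprn_ge0.
  apply: ler_wpM2l => //.
  rewrite mulrC mulrCA; apply: ler_wpM2l => //.
  by apply: weight_shift; rewrite (le_trans xX)// ler_norm.
have h0 := derivs_leW (step _ Hc0).
have Fb := derivs_le_bound (step _ Hc1).
have [F' dF hF'] := derivs_leS (step _ Hc1).
have B'K y : B' y <= D * K * (weight y ^+ N / oneDsqr y).
  rewrite /B' -mulrA; apply: ler_wpM2l => //.
  rewrite ler_pdivrMr ?weight_gt0// (le_trans (BK y))//.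
  rewrite (_ : K * (weight y ^+ N.+1 / _) = K * (weight y ^+ N / oneDsqr y) * weight y) //.
  by rewrite exprS; ring.
have B'b y : B y <= b -> B' y <= D * b.
  move=> By; apply: ler_wpM2l => //; apply: le_trans By.
  by rewrite ler_pdivrMr ?weight_gt0// ler_peMr// weight_ge1.
(* The two integrals produced by the integration by parts. *)
have I0 := IH a x theta A _ _ _ _ aa0 xX A0 h0 B'K (B'b _ BA) (B'b _ BNA).
have I1 := IH a x (theta - pi / 2) A _ _ _ _ aa0 xX A0 hF' B'K (B'b _ BA) (B'b _ BNA).
have FA := le_trans (Fb A) (B'b _ BA).
have FNA := le_trans (Fb (- A)) (B'b _ BNA).
rewrite (oscillation_parts theta a_gt0 A0 (derivs_le_continuous hB) dF
  (derivs_le_continuous hF')).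
set J0 := (X in X + _); set J1 := (X in _ - X).
rewrite -/J0 in I0; rewrite -/J1 in I1.
have ia : (2 * a)^-1 <= (2 * a0)^-1.
  by rewrite lef_pV2 ?posrE ?mulr_gt0// ler_pM2l.
have W1 y : `|lorentz_odd x y * h y * wave a x (theta - pi / 2) y| <= `|lorentz_odd x y * h y|.
  by rewrite normrM ler_piMr// wave_le1.
apply: (@le_trans _ _ (C1 * (D * K + D * b) +
    (2 * a0)^-1 * (D * b + D * b + C1 * (D * K + D * b)))).
  rewrite (le_trans (ler_normD _ _))// lerD//.
  rewrite normrM ler_pM// ?invr_ge0 ?mulr_ge0 ?(ltW a_gt0)//.
    by rewrite ger0_norm// invr_ge0 mulr_ge0// ltW.
  rewrite (le_trans (ler_normB _ _))// lerD//.
  by rewrite (le_trans (ler_normB _ _))// lerD// (le_trans (W1 _)).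
have -> : C1 * (D * K + D * b) +
  (2 * a0)^-1 * (D * b + D * b + C1 * (D * K + D * b)) =
  (C1 * D + C1 * D / (2 * a0)) * (K + b) + D / a0 * b.
  by field; rewrite gt_eqF.
rewrite (_ : C1 * D + D / a0 + _ = C1 * D + C1 * D / (2 * a0) + D / a0); last first.
  by rewrite addrAC.
rewrite [leRHS]mulrDl lerD// ler_wpM2l ?lerDr//.
by rewrite divr_ge0// ltW.
Qed.

End OscillationBound.

(** * Oscillatory integrals over the line *)

Section WholeLine.
Context {R : realType}.
Implicit Types (x y a theta K b A : R) (B h f : R -> R).
Notation mu := (@lebesgue_measure R).

Lemma integrable_oneDsqrV K :
  mu.-integrable setT (EFin \o (fun y : R => K / oneDsqr y)).
Proof.
have cV := @continuous_oneDsqrV R.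
suff : mu.-integrable setT (EFin \o (fun y : R => (oneDsqr y)^-1)).
  by move=> /(integrableZl measurableT K).
have p0 y : 0 <= (oneDsqr y : R)^-1.
  by rewrite invr_ge0 (le_trans _ (oneDsqr_ge1 _)).
apply/integrableP; split.
  by apply/measurable_EFinP; exact: continuous_measurable_fun.
under eq_integral => y _ do rewrite /= ger0_norm//.
rewrite ge0_symfun_integralT//; last by move=> y; rewrite /= /oneDsqr sqrrN.
by rewrite -set_itvcy integral0y_oneDsqr -EFinM ltry.
Qed.

Lemma integrable_oneDsqr_le K f : continuous f ->
  (forall y, `|f y| <= K / oneDsqr y) -> mu.-integrable setT (EFin \o f).
Proof.
move=> cf fK; apply: (le_integrable _ _ _ (integrable_oneDsqrV K)) => //.
  by apply/measurable_EFinP; exact: continuous_measurable_fun.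
by move=> y _; rewrite lee_fin (le_trans (fK y))// ler_norm.
Qed.

(** Dominated convergence for the restrictions of f to the segments. *)
Lemma cvg_Rintegral_segments f : mu.-integrable setT (EFin \o f) ->
  \int[mu]_(y in `[- n%:R, n%:R]) f y @[n --> \oo] --> \int[mu]_y f y.
Proof.
move=> intf; have /measurable_int mf := intf.
pose f_ n := EFin \o (f \_ `[- n%:R : R, n%:R]).
have mf_ n : measurable_fun setT (f_ n).
  apply/measurable_EFinP.
  apply/(measurable_restrictT f); first exact: measurable_itv.
  by apply: measurable_funTS; exact/measurable_EFinP.
have f_f : {ae mu, forall y, setT y -> f_ ^~ y @ \oo --> (EFin \o f) y}.
  apply: aeW => y _; apply: cvg_near_cst.
  near=> n; rewrite /f_ /= patchE ifT// inE /= in_itv /= -ler_norml.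
  by near: n; exact: nbhs_infty_ger.
have intnf : mu.-integrable setT (fun y => `|(f y)%:E|%E) by exact: integrable_abse intf.
have f_le : {ae mu, forall y n, setT y -> (`|f_ n y| <= `|(f y)%:E|)%E}.
  apply: aeW => y n _ /=; rewrite lee_fin patchE.
  by case: ifPn => // _; rewrite normr0.
have [_ _ H] := @dominated_convergence _ _ _ mu _ measurableT _ _ _ mf_ mf f_f intnf f_le.
have -> : (fun n => \int[mu]_(y in `[- n%:R, n%:R]) f y) =
    (fun n => fine (\int[mu]_(y in setT) (f_ n y))%E).
  by apply/funext => n; rewrite Rintegral_mkcond.
apply: fine_cvg; rewrite fineK; first exact: H.
exact: integrable_fin_num intf.
Unshelve. all: by end_near. Qed.

(** The second bound, with its arbitrary L, makes the integral absolutely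
    convergent and kills the boundary terms at infinity, but does not enter the
    estimate. *)
Lemma oscillation_line N (a0 X : R) : 0 < a0 -> exists2 C : R, 0 <= C &
  forall a x theta K L h, a0 <= a -> `|x| <= X ->
    derivs_le N (fun y => K * (weight y ^+ N / oneDsqr y)) h ->
    derivs_le N (fun y => L / oneDsqr y) h ->
    `|\int[mu]_y (wave a x theta y * h y)| <= C * K.
Proof.
move=> a0_gt0; have [C C0 HC] := @oscillation_segment R N _ X a0_gt0.
exists C => // a x theta K L h aa0 xX hK hL.
have intf : mu.-integrable setT (EFin \o (fun y => wave a x theta y * h y)).
  apply: (@integrable_oneDsqr_le L).
    move=> y; apply: cvgM; first exact: wave_continuous.
    exact: (derivs_le_continuous hL).
  move=> y; rewrite normrM (le_trans (ler_piMl _ (wave_le1 _ _ _ _)))//.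
  exact: derivs_le_bound hL y.
have HB := derivs_le_min hK hL.
have cv : C * (K + L / oneDsqr (n%:R : R)) @[n --> \oo] --> C * (K + L * 0).
  apply: cvgMr; apply: cvgD; first exact: cvg_cst.
  apply: cvgMr; apply/gtr0_cvgV0.
    by near=> n; rewrite (lt_le_trans _ (oneDsqr_ge1 _)).
  apply: (ger_cvgy _ (@cvgr_idn R)).
  near=> n; rewrite /oneDsqr; have := ler0n R n; nra.
rewrite mulr0 addr0 in cv.
rewrite -(cvg_lim _ cv)//.
rewrite -(cvg_lim _ (cvg_norm (cvg_Rintegral_segments intf)))//.
apply: ler_lim.
- by apply/cvg_ex; eexists; exact: cvg_norm (cvg_Rintegral_segments intf).
- by apply/cvg_ex; eexists; exact: cv.
near=> n; apply: (HC _ _ _ _ _ _ _ _ aa0 xX _ HB) => //.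
- by rewrite ltr0n; near: n; exact: nbhs_infty_gt.
- by move=> y; rewrite ge_min lexx.
- by rewrite ge_min lexx orbT.
- by rewrite ge_min /oneDsqr sqrrN lexx orbT.
Unshelve. all: by end_near. Qed.

End WholeLine.

(** * Gaussian regularizers *)

Section Gaussian.
Context {R : realType}.
Implicit Types (x y a theta K eta : R) (h : R -> R).
Notation mu := (@lebesgue_measure R).

(** With eta the square root of eps this is the regularizing factor
    exp (- eps y^2); in terms of eta it is a rescaling of a fixed function, so
    that k derivatives produce a factor eta^k. *)
Definition gauss eta y : R := expR (- (eta * y) ^+ 2).

(** With q = j + p + 1 and u = eta * y, it comes from 1 + |u| <= 2 q (1 + u^2 / q)
    and (1 + u^2 / q)^q <= exp (u^2). *)
Lemma monomial_gauss_bound j p : exists2 C : R, 0 <= C &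
  forall eta y, `|(eta * y) ^+ j * gauss eta y| <= C / (1 + `|eta * y|) ^+ p.
Proof.
pose q := (j + p).+1; exists ((2 * q%:R) ^+ q) => [|eta y].
  by rewrite exprn_ge0// mulr_ge0.
rewrite /gauss; move: (eta * y) => u.
have r1 : 1 <= 1 + `|u| by rewrite lerDl.
have r0 : 0 < 1 + `|u| by rewrite (lt_le_trans _ r1).
have q0 : 0 < q%:R :> R by rewrite ltr0n.
rewrite ler_pdivlMr ?exprn_gt0// normrM (gtr0_norm (expR_gt0 _)) expRN.
rewrite mulrAC ler_pdivrMr ?expR_gt0// normrX.
apply: (@le_trans _ _ ((1 + `|u|) ^+ q)).
  apply: (@le_trans _ _ ((1 + `|u|) ^+ (j + p))).
    rewrite exprD ler_wpM2r ?exprn_ge0 ?(ltW r0)//.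
    by rewrite lerXn2r// ?nnegrE// ?(ltW r0)// lerDr.
  by rewrite exprS ler_peMl// exprn_ge0// ltW.
have -> : expR (u ^+ 2) = expR (u ^+ 2 / q%:R) ^+ q.
  by rewrite -expRM_natl mulrC divfK// gt_eqF.
rewrite -exprMn; apply: lerXn2r; rewrite ?nnegrE ?(ltW r0)// ?mulr_ge0 ?expR_ge0//.
apply: (@le_trans _ _ (2 * q%:R * (1 + u ^+ 2 / q%:R))); last first.
  by rewrite ler_pM2l ?mulr_gt0// expR_ge1Dx.
rewrite mulrDr mulr1 -mulrA (mulrC q%:R) divfK ?gt_eqF//.
have : 1 <= q%:R :> R by rewrite ler1n.
rewrite -(real_normK (num_real u)); have := normr_ge0 u; nra.
Qed.

Lemma is_derive_monomial_gauss j eta y :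
  is_derive y 1 (fun y => (eta * y) ^+ j * gauss eta y)
    (eta * j%:R * ((eta * y) ^+ j.-1 * gauss eta y)
     + (- 2 * eta) * ((eta * y) ^+ j.+1 * gauss eta y)).
Proof.
have D1 : is_derive y 1 (fun y => eta * y) eta.
  by apply: is_derive_eq; rewrite /GRing.scale /= mulr1.
have D2 : is_derive y 1 (fun y => (eta * y) ^+ j) (j%:R * (eta * y) ^+ j.-1 * eta).
  have := @is_deriveX _ _ (fun y => eta * y) j y 1 eta D1.
  by rewrite exprfctE.
have D3 : is_derive y 1 (fun y => - (eta * y) ^+ 2) (- (2 * (eta * y) * eta)).
  by apply: is_derive_eq; rewrite /GRing.scale /=; ring.
have D4 : is_derive y 1 (gauss eta) (gauss eta y * - (2 * (eta * y) * eta)).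
  exact: is_derive1_comp (is_derive_expR _) D3.
set t := (X in is_derive _ _ _ X).
have := is_deriveM D2 D4; set d := (X in is_derive _ _ _ X).
suff -> : d = t by [].
by rewrite /d /t /GRing.scale /= exprS; ring.
Qed.

(** The monomial factor is there for the induction on N: the derivative of
    such a function is a combination of two functions of the same kind. *)
Lemma gauss_derivs_le N j p : exists2 C : R, 0 <= C &
  forall eta, 0 <= eta -> eta <= 1 ->
  derivs_le N (fun y => C / (1 + `|eta * y|) ^+ p)
    (fun y => (eta * y) ^+ j * gauss eta y).
Proof.
elim: N j => [|N IH] j; have [C C0 HC] := monomial_gauss_bound j p.
  exists C => // eta e0 e1; split; first exact: HC.
  by apply: is_derive_continuous => y; exact: is_derive_monomial_gauss.
have [C1 C10 H1] := IH j.-1; have [C2 C20 H2] := IH j.+1.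
have D0 : 0 <= j%:R * C1 + 2 * C2 by rewrite addr_ge0// mulr_ge0.
exists (C + (j%:R * C1 + 2 * C2)) => [|eta e0 e1]; first exact: addr_ge0.
have r0 y : 0 <= ((1 + `|eta * y|) ^+ p)^-1 by rewrite invr_ge0 exprn_ge0// addr_ge0.
split.
  move=> y; rewrite (le_trans (HC _ _))// ler_wpM2r ?r0//.
  by rewrite lerDl.
eexists; first by move=> y; exact: is_derive_monomial_gauss.
apply: derivs_le_mono (derivs_leD (derivs_leZ _ (H1 _ e0 e1)) (derivs_leZ _ (H2 _ e0 e1))) => y.
have := r0 y; move: ((_ ^+ p)^-1) => r r_ge0.
rewrite !normrM normrN !normr_nat (ger0_norm e0) !mulrA -mulrDl ler_wpM2r//.
apply: (@le_trans _ _ (j%:R * C1 + 2 * C2)); last by rewrite lerDr.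
rewrite -mulrA (mulrAC 2) lerD//.
  by rewrite ler_piMl// mulr_ge0.
by rewrite ler_piMr// mulr_ge0.
Qed.

Lemma gauss_derivs_le0 N p : exists2 C : R, 0 <= C &
  forall eta, 0 <= eta -> eta <= 1 ->
  derivs_le N (fun y => C / (1 + `|eta * y|) ^+ p) (gauss eta).
Proof.
have [C C0 HC] := gauss_derivs_le N 0 p; exists C => // eta e0 e1.
suff -> : gauss eta = (fun y => (eta * y) ^+ 0 * gauss eta y) by exact: HC.
by apply/funext => y; rewrite mul1r.
Qed.

(** The regularizer tends to 1 at rate eta at the price of one order of growth:
    |exp (- u^2) - 1| <= |u| at order 0, and each derivative contains a factor
    eta. *)
Lemma gauss_sub1_derivs_le N : exists2 C : R, 0 <= C &
  forall eta, 0 <= eta -> eta <= 1 ->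
  derivs_le N (fun y => C * eta * weight y) (fun y => gauss eta y - 1).
Proof.
have D eta y : is_derive y 1 (fun y => gauss eta y - 1)
    ((- 2 * eta) * ((eta * y) ^+ 1 * gauss eta y)).
  have -> : (fun y => gauss eta y - 1) = ((fun y => (eta * y) ^+ 0 * gauss eta y) - cst 1).
    by apply/funext => z; rewrite fctE /= ?expr0 mul1r.
  have := is_deriveB (is_derive_monomial_gauss 0 eta y) (is_derive_cst (1 : R) y 1).
  by rewrite mulr0 mul0r add0r subr0.
have B0 eta y : 0 <= eta -> `|gauss eta y - 1| <= eta * weight y.
  move=> e0; have le1 : gauss eta y <= 1.
    by rewrite /gauss -expR0 ler_expR lerNl oppr0 sqr_ge0.
  have ge1 : 1 - (eta * y) ^+ 2 <= gauss eta y by rewrite /gauss expR_ge1Dx.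
  rewrite ler0_norm ?subr_le0// opprB /weight mulrDr mulr1.
  have -> : eta * `|y| = `|eta * y| by rewrite normrM ger0_norm.
  rewrite -(real_normK (num_real (eta * y))) in ge1.
  have g0 : 0 < gauss eta y := expR_gt0 _.
  by have := normr_ge0 (eta * y); have [] := leP `|eta * y| 1; nra.
case: N => [|N].
  exists 1 => // eta e0 e1; split => [y|]; first by rewrite mul1r B0.
  by apply: is_derive_continuous => y; exact: D.
have [C C0 HC] := gauss_derivs_le N 1 0.
exists (1 + 2 * C) => [|eta e0 e1]; first by rewrite addr_ge0// mulr_ge0.
split => [y|].
  rewrite (le_trans (B0 _ _ e0))// -mulrA ler_peMl//; last by rewrite lerDl mulr_ge0.
  by rewrite mulr_ge0// ltW// weight_gt0.
eexists; first by move=> y; exact: D.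
apply: derivs_le_mono (derivs_leZ _ (HC _ e0 e1)) => y.
rewrite !normrM normrN !normr_nat (ger0_norm e0) expr0 divr1.
have := weight_ge1 y; have : 0 <= C * eta by rewrite mulr_ge0.
nra.
Qed.

End Gaussian.

(** * Damped oscillatory integrals *)

Section Damped.
Context {R : realType}.
Implicit Types (x y a theta K L eta : R) (f h : R -> R).
Notation mu := (@lebesgue_measure R).

Lemma oneDsqr_le_weight y : oneDsqr y <= weight y ^+ 2.
Proof.
rewrite /oneDsqr /weight -(real_normK (num_real y)).
by have := normr_ge0 y; nra.
Qed.

Lemma weight_frac k y : weight y ^+ k.+1 <= weight y ^+ (k + 3) / oneDsqr y.
Proof.
rewrite ler_pdivlMr ?(lt_le_trans _ (oneDsqr_ge1 _))// -addSnnS exprD.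
by rewrite ler_wpM2l ?oneDsqr_le_weight// exprn_ge0// ltW// weight_gt0.
Qed.

(** For a fixed eta > 0 the regularizer beats every power of the weight, which
    makes all damped integrals absolutely convergent. *)
Lemma gauss_mul_decay N k eta K h : 0 < eta -> eta <= 1 ->
  derivs_le N (fun y => K * weight y ^+ k) h ->
  exists L, derivs_le N (fun y => L / oneDsqr y) (fun y => gauss eta y * h y).
Proof.
move=> e0 e1 hK; have [C C0 HC] := @gauss_derivs_le0 R N k.+2.
have K0 : 0 <= K.
  have := le_trans (normr_ge0 _) (derivs_le_bound hK 0).
  by rewrite pmulr_lge0// exprn_gt0// weight_gt0.
have {}HC := HC _ (ltW e0) e1.
exists (2 ^+ N * (C / eta ^+ k.+2 * K)).
apply: derivs_le_mono (derivs_leM HC hK) => y.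
rewrite -!mulrA; apply: ler_wpM2l; first exact: exprn_ge0.
apply: ler_wpM2l => //.
have w0 := weight_gt0 y.
have ew : eta * weight y <= 1 + `|eta * y|.
  by rewrite /weight mulrDr mulr1 normrM (gtr0_norm e0) lerD2r.
have ew0 : 0 < eta * weight y by rewrite mulr_gt0.
apply: (@le_trans _ _ ((eta * weight y) ^- k.+2 * (K * weight y ^+ k))).
  apply: ler_wpM2r; first by rewrite mulr_ge0// exprn_ge0// ltW.
  rewrite lef_pV2 ?posrE ?exprn_gt0// ?(lt_le_trans ew0)//.
  by rewrite lerXn2r ?nnegrE ?(ltW ew0)// (le_trans (ltW ew0)).
rewrite exprMn invfM -mulrA ler_wpM2l ?invr_ge0 ?exprn_ge0 ?(ltW e0)//.
rewrite mulrCA ler_wpM2l// -addn2 exprD invfM mulrAC mulVf ?mul1r; last first.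
  by rewrite gt_eqF// exprn_gt0.
rewrite lef_pV2 ?posrE ?exprn_gt0 ?(lt_le_trans _ (oneDsqr_ge1 _))//.
exact: oneDsqr_le_weight.
Qed.

(** The exponents are such that the product of the bounds of f and h is at most
    weight^(k + 1), hence at most weight^(k + 3) times the integrable
    function 1 / (1 + y^2). *)
Lemma oscillation_multiplier k (a0 X : R) : 0 < a0 -> exists2 C : R, 0 <= C &
  forall a x theta K M L f h, a0 <= a -> `|x| <= X ->
    derivs_le (k + 3) (fun y => K * weight y ^+ k) h ->
    derivs_le (k + 3) (fun y => M * weight y) f ->
    derivs_le (k + 3) (fun y => L / oneDsqr y) (fun y => f y * h y) ->
    `|\int[mu]_y (wave a x theta y * (f y * h y))| <= C * (M * K).
Proof.
move=> a0_gt0; have [C C0 HC] := @oscillation_line R (k + 3) a0 X a0_gt0.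
exists (C * 2 ^+ (k + 3)) => [|a x theta K M L f h aa0 xX hK fM fhL].
  by rewrite mulr_ge0// exprn_ge0.
rewrite -mulrA; apply: HC aa0 xX _ fhL.
apply: derivs_le_mono (derivs_leM fM hK) => y.
have K0 : 0 <= K.
  have := le_trans (normr_ge0 _) (derivs_le_bound hK 0).
  by rewrite pmulr_lge0// exprn_gt0// weight_gt0.
have M0 : 0 <= M.
  have := le_trans (normr_ge0 _) (derivs_le_bound fM 0).
  by rewrite pmulr_lge0// weight_gt0.
rewrite -[leRHS]mulrA; apply: ler_wpM2l; first exact: exprn_ge0.
rewrite -mulrA (mulrCA (weight y)) -exprS [leLHS]mulrA; apply: ler_wpM2l; first exact: mulr_ge0.
exact: weight_frac.
Qed.

Definition damped eta a x theta h : R :=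
  \int[mu]_y (wave a x theta y * (gauss eta y * h y)).

Lemma damped_integrable N k eta a x theta K h : 0 < eta -> eta <= 1 ->
  derivs_le N (fun y => K * weight y ^+ k) h ->
  mu.-integrable setT (EFin \o (fun y => wave a x theta y * (gauss eta y * h y))).
Proof.
move=> e0 e1 hK; have [L HL] := gauss_mul_decay e0 e1 hK.
apply: (@integrable_oneDsqr_le _ L).
  move=> y; apply: cvgM; first exact: wave_continuous.
  exact: (derivs_le_continuous HL).
move=> y; rewrite normrM (le_trans (ler_piMl _ (wave_le1 _ _ _ _)))//.
exact: derivs_le_bound HL y.
Qed.

(** The multiplier is the regularizer in the first estimate and a difference of
    two regularizers in the second one.  The second estimate is a Cauchy
    criterion as the damping tends to 0. *)
Lemma damped_bound k (a0 X : R) : 0 < a0 -> exists2 C : R, 0 <= C &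
  forall a x theta K h, a0 <= a -> `|x| <= X ->
    derivs_le (k + 3) (fun y => K * weight y ^+ k) h ->
    (forall eta, 0 < eta -> eta <= 1 -> `|damped eta a x theta h| <= C * K) /\
    (forall eta1 eta2, 0 < eta1 -> eta1 <= 1 -> 0 < eta2 -> eta2 <= 1 ->
       `|damped eta1 a x theta h - damped eta2 a x theta h|
         <= C * (eta1 + eta2) * K).
Proof.
move=> a0_gt0; have [C C0 HC] := oscillation_multiplier k X a0_gt0.
have [C1 C10 H1] := @gauss_derivs_le0 R (k + 3) 0.
have [C2 C20 H2] := @gauss_sub1_derivs_le R (k + 3).
exists (C * (C1 + C2)) => [|a x theta K h aa0 xX hK].
  by rewrite mulr_ge0// addr_ge0.
have K0 : 0 <= K.
  have := le_trans (normr_ge0 _) (derivs_le_bound hK 0).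
  by rewrite pmulr_lge0// exprn_gt0// weight_gt0.
split=> [eta e0 e1|e e' e0 e1 e'0 e'1].
  have [L HL] := gauss_mul_decay e0 e1 hK.
  apply: (@le_trans _ _ (C * (C1 * K))).
    apply: HC hK _ HL => //.
    apply: derivs_le_mono (H1 _ (ltW e0) e1) => y; rewrite expr0 divr1 ler_peMr//.
    exact: weight_ge1.
  by rewrite -mulrA ler_wpM2l// ler_wpM2r// lerDl.
have [L HL] := gauss_mul_decay e0 e1 hK.
have [L' HL'] := gauss_mul_decay e'0 e'1 hK.
(* The difference is estimated through 1, the limit of both regularizers. *)
pose f y := (gauss e y - 1) + -1 * (gauss e' y - 1).
have fE y : f y = gauss e y - gauss e' y by rewrite /f; ring.
rewrite /damped -RintegralB//; try exact: damped_integrable hK.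
rewrite (_ : (fun y => _) = fun y => wave a x theta y * (f y * h y)); last first.
  by apply/funext => y; rewrite fE; ring.
apply: (@le_trans _ _ (C * (C2 * (e + e') * K))).
  apply: (HC _ _ _ _ _ (L + L')) hK _ _ => //.
  - apply: derivs_le_mono (derivs_leD (H2 _ (ltW e0) e1)
      (derivs_leZ (-1) (H2 _ (ltW e'0) e'1))) => y.
    by rewrite normrN1 mul1r -mulrDl -mulrDr.
  - have -> : (fun y => f y * h y) =
        (fun y => gauss e y * h y + -1 * (gauss e' y * h y)).
      by apply/funext => y; rewrite fE; ring.
    apply: derivs_le_mono (derivs_leD HL (derivs_leZ (-1) HL')) => y.
    by rewrite normrN1 mul1r -mulrDl.
rewrite -!mulrA ler_wpM2l// ler_wpM2r ?lerDr// mulr_ge0// addr_ge0// ltW//.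
Qed.

Lemma damped_cvg k a x theta K h : 0 < a ->
  derivs_le (k + 3) (fun y => K * weight y ^+ k) h ->
  cvg (damped (Num.sqrt eps) a x theta h @[eps --> (0 : R)^'+]).
Proof.
move=> a0 hK; have [C C0 HC] := damped_bound k `|x| a0.
have [_ H] := HC a x theta K h (lexx _) (lexx _) hK.
have K0 : 0 <= K.
  have := le_trans (normr_ge0 _) (derivs_le_bound hK 0).
  by rewrite pmulr_lge0// exprn_gt0// weight_gt0.
have CK : 0 <= C * K by rewrite mulr_ge0.
apply/cauchy_cvgP/cauchy_exP => e e0.
have q0 : 0 < 4 * (C * K + 1) by rewrite mulr_gt0// ltr_wpDl.
(* Two dampings at most d give values at distance at most
   2 * d * (C * K) < e. *)
pose d := Num.min 1 (e / (4 * (C * K + 1))).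
have d0 : 0 < d by rewrite lt_min ltr01 divr_gt0.
have d1 : d <= 1 by rewrite ge_min lexx.
have de : d * (4 * (C * K + 1)) <= e by rewrite -ler_pdivlMr// ge_min lexx orbT.
exists (damped d a x theta h).
suff : \forall s \near (0 : R)^'+,
  ball (damped d a x theta h) e (damped (Num.sqrt s) a x theta h) by [].
near=> s; rewrite /= -ball_normE /=.
have s0 : 0 < s by near: s; exact: nbhs_right_gt.
have sd : Num.sqrt s <= d.
  rewrite -(ger0_norm (ltW d0)) -sqrtr_sqr ler_sqrt ?sqr_ge0//.
  by near: s; apply: nbhs_right_le; rewrite exprn_gt0.
apply: (@le_lt_trans _ _ (C * (d + Num.sqrt s) * K)).
  by apply: H; rewrite ?sqrtr_gt0// (le_trans sd).
rewrite mulrAC; have := sqrtr_ge0 s; nra.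
Unshelve. all: by end_near. Qed.

End Damped.

(** * The weighted spaces of complex functions *)

Section FunctionSpaces.
Local Open Scope complex_scope.
Context {R : realType}.
Implicit Types (x y alpha beta : R) (f g : R -> R[i]).
Local Notation Re := (@complex.Re R).
Local Notation Im := (@complex.Im R).

Lemma derivs_le_derive1n n (B g : R -> R) :
  (forall k s, (k < n)%N -> derivable (derive1n k g) s 1) ->
  (forall k, (k <= n)%N -> continuous (derive1n k g)) ->
  (forall k y, (k <= n)%N -> `|derive1n k g y| <= B y) ->
  derivs_le n B g.
Proof.
elim: n g => [|n IH] g dg cg gB; split.
- by move=> y; exact: (gB 0).
- exact: (cg 0).
- by move=> y; exact: (gB 0).
- exists (derive1 g) => [y|].
    by rewrite derive1E; apply: derivableP; exact: (dg 0).
  apply: IH => [k s kn|k kn|k y kn]; rewrite -derive1Sn.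
  + exact: dg.
  + exact: cg.
  + exact: gB.
Qed.

Lemma derive1nB n (f g : R -> R) :
  (forall k s, (k < n)%N -> derivable (derive1n k f) s 1) ->
  (forall k s, (k < n)%N -> derivable (derive1n k g) s 1) ->
  derive1n n (fun y => f y - g y) = (fun y => derive1n n f y - derive1n n g y).
Proof.
elim: n => [|n IH] df dg //.
rewrite derive1nS IH; last 2 first.
- by move=> k s kn; apply: df; exact: ltnW.
- by move=> k s kn; apply: dg; exact: ltnW.
apply/funext => y; rewrite !derive1nS !derive1E.
by apply: deriveB; [exact: df|exact: dg].
Qed.

Lemma normc_ge_ReIm (z : R[i]) :
  `|Re z| <= Normc.normc z /\ `|Im z| <= Normc.normc z.
Proof.
case: z => a b /=; rewrite -[`|a|]sqrtr_sqr -[`|b|]sqrtr_sqr.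
by split; apply: ler_wsqrtr; rewrite ?lerDl ?lerDr sqr_ge0.
Qed.

Lemma normc_le_ReIm (z : R[i]) : Normc.normc z <= `|Re z| + `|Im z|.
Proof.
case: z => a b /=.
rewrite -[leRHS]ger0_norm ?addr_ge0// -sqrtr_sqr; apply: ler_wsqrtr.
rewrite sqrrD !real_normK ?num_real//.
by rewrite lerD2r lerDl mulrn_wge0// mulr_ge0.
Qed.

Lemma le_normcB (z w : R[i]) :
  Normc.normc (z - w) <= Normc.normc z + Normc.normc w.
Proof. by rewrite -lecR rmorphD; exact: (ler_normB z w). Qed.

Lemma weight_powR_gt0 alpha y : 0 < weight y `^ alpha.
Proof. by rewrite powR_gt0// weight_gt0. Qed.

Lemma Cnw_norm_ge0 n alpha f : 0 <= Cnw_norm n alpha f.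
Proof. by rewrite /Cnw_norm; apply: bigmax_ge_id. Qed.

(** Membership in the weighted space bounds the sets whose suprema define the
    norm, so that these suprema are upper bounds. *)
Lemma Cnw_le_norm n alpha f k y : Cnw n alpha f -> (k <= n)%N ->
  Normc.normc (Cderiven k f y) <= Cnw_norm n alpha f * weight y `^ alpha.
Proof.
move=> [_ [M M0 HM]] kn; rewrite -ler_pdivrMr ?weight_powR_gt0//.
have kn1 : (k < n.+1)%N by [].
apply: le_trans (le_bigmax 0 _ (Ordinal kn1)).
apply: ub_le_sup; last by exists y.
exists M => _ [z _ <-]; rewrite ler_pdivrMr ?weight_powR_gt0//.
exact: HM.
Qed.

Lemma Cnw_derivs_le n alpha f : Cnw n alpha f ->
  derivs_le n (fun y => Cnw_norm n alpha f * weight y `^ alpha) (Re \o f) /\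
  derivs_le n (fun y => Cnw_norm n alpha f * weight y `^ alpha) (Im \o f).
Proof.
move=> Hf; have [[df cf] _] := Hf.
split; apply: derivs_le_derive1n => [k s kn|k kn|k y kn].
- exact: (df k s kn).1.
- exact: (cf k kn).1.
- by rewrite (le_trans _ (Cnw_le_norm y Hf kn))// (normc_ge_ReIm (Cderiven k f y)).1.
- exact: (df k s kn).2.
- exact: (cf k kn).2.
- by rewrite (le_trans _ (Cnw_le_norm y Hf kn))// (normc_ge_ReIm (Cderiven k f y)).2.
Qed.

Lemma CderivenB n f g : Cn n f -> Cn n g -> forall k, (k <= n)%N ->
  Cderiven k (fun y => f y - g y) = (fun y => Cderiven k f y - Cderiven k g y).
Proof.
move=> [df _] [dg _] k kn; apply/funext => y; rewrite /Cderiven.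
have -> : Re \o (fun y => f y - g y) = fun y => (Re \o f) y - (Re \o g) y.
  by apply/funext => z /=; case: (f z) (g z) => ? ? [].
have -> : Im \o (fun y => f y - g y) = fun y => (Im \o f) y - (Im \o g) y.
  by apply/funext => z /=; case: (f z) (g z) => ? ? [].
rewrite !derive1nB// => j s jk.
- exact: (df j s (leq_trans jk kn)).2.
- exact: (dg j s (leq_trans jk kn)).2.
- exact: (df j s (leq_trans jk kn)).1.
- exact: (dg j s (leq_trans jk kn)).1.
Qed.

Lemma CnwB n alpha f g : Cnw n alpha f -> Cnw n alpha g ->
  Cnw n alpha (fun y => f y - g y).
Proof.
move=> [Cf [M M0 HM]] [Cg [M' M'0 HM']].
have E := CderivenB Cf Cg.
have [df cf] := Cf; have [dg cg] := Cg.
have ReB (u v : R -> R[i]) : Re \o (fun y => u y - v y) = (Re \o u) - (Re \o v).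
  by apply/funext => z; rewrite !fctE /=; case: (u z) (v z) => ? ? [].
have ImB (u v : R -> R[i]) : Im \o (fun y => u y - v y) = (Im \o u) - (Im \o v).
  by apply/funext => z; rewrite !fctE /=; case: (u z) (v z) => ? ? [].
split; first split.
- move=> k s kn; rewrite (E k (ltnW kn)) /Cderivable ReB ImB.
  by split; apply: derivableB;
    [exact: (df k s kn).1|exact: (dg k s kn).1|exact: (df k s kn).2|exact: (dg k s kn).2].
- move=> k kn; rewrite (E k kn) ReB ImB.
  by split=> y; apply: cvgB;
    [exact: (cf k kn).1|exact: (cg k kn).1|exact: (cf k kn).2|exact: (cg k kn).2].
exists (M + M') => [|y k kn]; first exact: addr_ge0.
rewrite (E k kn) mulrDl (le_trans (le_normcB _ _))//.
by rewrite lerD ?HM ?HM'.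
Qed.

(** The product of the growth orders alpha and beta is rounded up to an integer
    power of the weight.  The exponent k + 4 collects the k + 3 of the Leibniz
    rule and the two products of real functions in each component. *)
Lemma Cnw_mul_derivs_le k alpha beta g h :
  0 <= alpha -> 0 <= beta -> alpha + beta <= k%:R ->
  Cnw (k + 3) alpha g -> Cnw (k + 3) beta h ->
  let B y := 2 ^+ (k + 4) * (Cnw_norm (k + 3) alpha g * Cnw_norm (k + 3) beta h)
             * weight y ^+ k in
  derivs_le (k + 3) B (fun y => Re (g y * h y)) /\
  derivs_le (k + 3) B (fun y => Im (g y * h y)).
Proof.
move=> a0 b0 abk Hg Hh B.
have [gR gI] := Cnw_derivs_le Hg; have [hR hI] := Cnw_derivs_le Hh.
set Kg := Cnw_norm (k + 3) alpha g in gR gI B *.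
set Kh := Cnw_norm (k + 3) beta h in hR hI B *.
have Kg0 : 0 <= Kg := Cnw_norm_ge0 _ _ _.
have Kh0 : 0 <= Kh := Cnw_norm_ge0 _ _ _.
have P y : Kg * weight y `^ alpha * (Kh * weight y `^ beta) <= Kg * Kh * weight y ^+ k.
  rewrite mulrACA ler_wpM2l ?mulr_ge0// -powRD; last first.
    by apply/implyP => _; rewrite gt_eqF// weight_gt0.
  by rewrite -powR_mulrn ?ler_powR ?weight_ge1// ltW// weight_gt0.
have step (d : R) (u v u' v' : R -> R) : `|d| = 1 ->
    derivs_le (k + 3) (fun y => Kg * weight y `^ alpha) u ->
    derivs_le (k + 3) (fun y => Kh * weight y `^ beta) v ->
    derivs_le (k + 3) (fun y => Kg * weight y `^ alpha) u' ->
    derivs_le (k + 3) (fun y => Kh * weight y `^ beta) v' ->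
    derivs_le (k + 3) B (fun y => u y * v y + d * (u' y * v' y)).
  move=> d1 hu hv hu' hv'.
  apply: derivs_le_mono (derivs_leD (derivs_leM hu hv)
    (derivs_leZ d (derivs_leM hu' hv'))) => y.
  rewrite d1 mul1r -mulr2n -[leLHS]mulr_natl [leLHS]mulrA -exprS -addnS /B -[leRHS]mulrA.
  by rewrite ler_wpM2l ?exprn_ge0.
split.
- have := step (-1) _ _ _ _ (normrN1 _) gR hR gI hI.
  congr derivs_le; apply/funext => y /=.
  by case: (g y) (h y) => ? ? [] ? ? /=; rewrite mulN1r.
- have := step 1 _ _ _ _ (normr1 _) gR hI gI hR.
  congr derivs_le; apply/funext => y /=.
  by case: (g y) (h y) => ? ? [] ? ? /=; rewrite mul1r.
Qed.

End FunctionSpaces.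

(** * The limit of vanishing damping *)

Section Limits.
Local Open Scope complex_scope.
Context {R : realType}.
Implicit Types (x y a theta : R) (h : R -> R).
Local Notation Re := (@complex.Re R).
Local Notation Im := (@complex.Im R).
Notation mu := (@lebesgue_measure R).

Definition damped_lim a x theta h : R :=
  lim (damped (Num.sqrt eps) a x theta h @[eps --> (0 : R)^'+]).

Lemma near_sqrt01 : \forall eps \near (0 : R)^'+,
  0 < Num.sqrt eps /\ Num.sqrt eps <= 1.
Proof.
near=> s; split.
  by rewrite sqrtr_gt0; near: s; exact: nbhs_right_gt.
by rewrite -sqrtr1 ler_sqrt//; near: s; exact: nbhs_right_le.
Unshelve. all: by end_near. Qed.

(** The bound on damped integrals is uniform in the damping, hence passes to
    the limit. *)
Lemma damped_lim_lipschitz k (a0 X : R) : 0 < a0 -> exists2 C : R, 0 <= C &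
  forall a x theta K1 K2 K h1 h2, a0 <= a -> `|x| <= X ->
    derivs_le (k + 3) (fun y => K1 * weight y ^+ k) h1 ->
    derivs_le (k + 3) (fun y => K2 * weight y ^+ k) h2 ->
    derivs_le (k + 3) (fun y => K * weight y ^+ k) (fun y => h1 y - h2 y) ->
    `|damped_lim a x theta h1 - damped_lim a x theta h2| <= C * K.
Proof.
move=> a0_gt0; have [C C0 HC] := damped_bound k X a0_gt0.
exists C => // a x theta K1 K2 K h1 h2 aa0 xX H1 H2 H12.
have a_gt0 : 0 < a by exact: lt_le_trans aa0.
have [H _] := HC a x theta K _ aa0 xX H12.
have c1 := @damped_cvg _ _ _ x theta _ _ a_gt0 H1.
have c2 := @damped_cvg _ _ _ x theta _ _ a_gt0 H2.
apply: (cvgr_to_le (cvg_norm (cvgB c1 c2))).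
near=> s; have [s0 s1] : 0 < Num.sqrt s /\ Num.sqrt s <= 1.
  by near: s; exact: near_sqrt01.
suff E : damped (Num.sqrt s) a x theta (fun y => h1 y - h2 y) =
    damped (Num.sqrt s) a x theta h1 - damped (Num.sqrt s) a x theta h2.
  by have := H _ s0 s1; rewrite E.
rewrite /damped -RintegralB//; [|exact: damped_integrable H1|exact: damped_integrable H2].
by apply: eq_Rintegral => y _; rewrite !mulrBr.
Unshelve. all: by end_near. Qed.

Lemma cvg_complex (T : Type) (F : set_system T) (FF : Filter F) (f g : T -> R) (l m : R) :
  f x @[x --> F] --> l -> g x @[x --> F] --> m ->
  (f x +i* g x : @Cfield R) @[x --> F] --> (l +i* m : @Cfield R).
Proof.
move=> fl gm; apply/cvgrPdist_le => e e0.
have [e1 e2] : 0 < complex.Re e /\ e = (complex.Re e)%:C.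
  move: e0; rewrite ltcE /= => /andP[/eqP i0 r0]; split=> //.
  by case: e i0 {r0} => a b /= ->.
have [/cvgrPdist_le/(_ _ (divr_gt0 e1 (ltr0n _ 2))) F1 /cvgrPdist_le/(_ _ (divr_gt0 e1 (ltr0n _ 2))) F2] := (fl, gm).
near=> s.
rewrite e2 (_ : `|_| = (Normc.normc ((l - f s) +i* (m - g s)))%:C) //.
rewrite lecR (le_trans (normc_le_ReIm _))//=.
rewrite [leRHS]splitr lerD//.
- by near: s; exact: F1.
- by near: s; exact: F2.
Unshelve. all: by end_near. Qed.

(** A quarter turn of the phase turns the cosine into the opposite of the sine,
    and back. *)
Lemma Re_regularized eps a x y (g h : R[i]) : 0 <= eps ->
  let z := (expR (- (eps * y ^+ 2)))%:C * (cis (a * (y - x) ^+ 2) * g) * h in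
  let e := gauss (Num.sqrt eps) y in
  Re z = wave a x 0 y * (e * Re (g * h)) + wave a x (pi / 2) y * (e * Im (g * h)) /\
  Im z = wave a x (- (pi / 2)) y * (e * Re (g * h)) + wave a x 0 y * (e * Im (g * h)).
Proof.
move=> e0 z e; have -> : z = e%:C * (cis (a * (y - x) ^+ 2) * g) * h.
  by rewrite /z /e /gauss exprMn sqr_sqrtr.
rewrite /wave addr0 cosDpihalf cosBpihalf /cis.
move: (cos _) (sin _) e => c s e; case: g h {z} => g1 g2 [h1 h2] /=.
by split; ring.
Qed.

Lemma regularized_damped G (g h : R -> R[i]) (a t x eps : R) k K : 0 < eps ->
  Num.sqrt eps <= 1 ->
  (forall y, G t x y = cis (a * (y - x) ^+ 2) * g y) ->
  derivs_le (k + 3) (fun y => K * weight y ^+ k) (fun y => Re (g y * h y)) ->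
  derivs_le (k + 3) (fun y => K * weight y ^+ k) (fun y => Im (g y * h y)) ->
  regularized G h t x eps =
  let D theta f := damped (Num.sqrt eps) a x theta f in
  let u y := Re (g y * h y) in let v y := Im (g y * h y) in
  (D 0 u + D (pi / 2) v) +i* (D (- (pi / 2)) u + D 0 v).
Proof.
move=> e0 e1 Gg Du Dv /=; rewrite /regularized /Cintegral.
have s0 : 0 < Num.sqrt eps by rewrite sqrtr_gt0.
rewrite /damped -!RintegralD//; try exact: damped_integrable Du; try exact: damped_integrable Dv.
congr (_ +i* _); apply: eq_Rintegral => y _; rewrite Gg.
- exact: (Re_regularized a x y (g y) (h y) (ltW e0)).1.
- exact: (Re_regularized a x y (g y) (h y) (ltW e0)).2.
Qed.

Lemma regularized_cvg G (g h : R -> R[i]) (a t x : R) k K : 0 < a ->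
  (forall y, G t x y = cis (a * (y - x) ^+ 2) * g y) ->
  derivs_le (k + 3) (fun y => K * weight y ^+ k) (fun y => Re (g y * h y)) ->
  derivs_le (k + 3) (fun y => K * weight y ^+ k) (fun y => Im (g y * h y)) ->
  let D theta f := damped_lim a x theta f in
  let u y := Re (g y * h y) in let v y := Im (g y * h y) in
  regularized G h t x eps @[eps --> (0 : R)^'+] -->
  ((D 0 u + D (pi / 2) v) +i* (D (- (pi / 2)) u + D 0 v) : @Cfield R).
Proof.
move=> a0 Gg Du Dv D u v.
have cu theta := @damped_cvg _ _ _ x theta _ _ a0 Du.
have cv theta := @damped_cvg _ _ _ x theta _ _ a0 Dv.
pose D' eps theta f := damped (Num.sqrt eps) a x theta f.
have cc : ((D' eps 0 u + D' eps (pi / 2) v) +i* (D' eps (- (pi / 2)) u + D' eps 0 v)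
      : @Cfield R) @[eps --> (0 : R)^'+] -->
    ((D 0 u + D (pi / 2) v) +i* (D (- (pi / 2)) u + D 0 v) : @Cfield R).
  by apply: cvg_complex; apply: cvgD; [exact: cu|exact: cv|exact: cu|exact: cv].
refine (cvg_trans _ cc); apply: near_eq_cvg; near=> s.
have [s0 s1] : 0 < Num.sqrt s /\ Num.sqrt s <= 1.
  by near: s; exact: near_sqrt01.
by rewrite (regularized_damped _ s1 Gg Du Dv)// -sqrtr_gt0.
Unshelve. all: by end_near. Qed.

End Limits.

(** * Continuity of the frequency *)

Section Continuity.
Local Open Scope complex_scope.
Context {R : realType}.
Local Notation Re := (@complex.Re R).
Notation mu := (@lebesgue_measure R).

(** Near t the function is a constant plus the integral of a locally integrable
    function from a fixed endpoint. *)
Lemma AC_continuous (T : \bar R) (a : R -> R) : Defs.AC (time_interval T) (fun t => (a t)%:C) ->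
  forall t, time_interval T t -> {for t, continuous a}.
Proof.
move=> [g [[mg oT gint] _] Ha] t Tt.
have [c [d [ct td cdT]]] : exists c d, [/\ c < t, t < d & `[c, d] `<=` time_interval T].
  have [e e0 He] : exists2 e, 0 < e & ball t e `<=` time_interval T.
    by have /nbhs_ballP[e e0 He] := open_nbhs_nbhs (conj oT Tt); exists e.
  exists (t - e / 2), (t + e / 2); split.
  - by rewrite ltrBlDr ltrDl divr_gt0.
  - by rewrite ltrDl divr_gt0.
  - move=> s; rewrite /= in_itv /= => /andP[s1 s2]; apply: He.
    rewrite -ball_normE /= ltr_norml; lra.
have intg : mu.-integrable `[c, d] (EFin \o (Re \o g)).
  apply/integrableP; split; last first.
    by apply: gint => //; exact: segment_compact.
  apply/measurable_EFinP; apply: measurable_funS mg => //.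
  by apply: open_measurable.
have cd : c < d by rewrite (lt_trans ct).
have cP := parameterized_integral_continuous (ltW cd) intg.
have Tc : time_interval T c.
  by apply: cdT; rewrite /= in_itv /= lexx ltW.
have tcd : t \in `]c, d[ by rewrite in_itv /= ct td.
have {}cP : {for t, continuous (fun s => \int[mu]_(r in `[c, s]) (Re \o g) r)}.
  exact: within_continuous_continuous cd cP tcd.
have aE s : s \in `]c, d[ -> a s = a c + \int[mu]_(r in `[c, s]) (Re \o g) r.
  rewrite in_itv /= => /andP[cs sd].
  have Ts : time_interval T s.
    by apply: cdT; rewrite /= in_itv /= (ltW cs) (ltW sd).
  have /(congr1 Re) := Ha c s Tc Ts cs.
  rewrite /Cintegral /= => <-.
  by rewrite addrC subrK.
have near_aE : \forall s \near t,
    a c + \int[mu]_(r in `[c, s]) (Re \o g) r = a s.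
  near=> s; rewrite -aE//; near: s; exact: near_in_itvoo.
suff : a s @[s --> t] --> a c + \int[mu]_(r in `[c, t]) (Re \o g) r.
  by rewrite -aE.
have cc : (a c + \int[mu]_(r in `[c, s]) (Re \o g) r) @[s --> t] -->
    a c + \int[mu]_(r in `[c, t]) (Re \o g) r.
  by apply: cvgD; [exact: cvg_cst|exact: cP].
refine (cvg_trans _ cc); exact: near_eq_cvg near_aE.
Unshelve. all: by end_near. Qed.

End Continuity.

(** * The solution as a function of the initial condition *)

Section Solution.
Local Open Scope complex_scope.
Context {R : realType}.
Implicit Types (G : R -> R -> R -> R[i]) (g h : R -> R[i]) (a t x alpha beta : R).
Local Notation Re := (@complex.Re R).
Local Notation Im := (@complex.Im R).

(** The value of the limit that defines Psi for G(t, x, y) = exp (i a (y - x)^2) g(y),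
    written with real oscillatory integrals. *)
Definition damped_solution a x g h : @Cfield R :=
  let D theta f := damped_lim a x theta f in
  let u y := Re (g y * h y) in let v y := Im (g y * h y) in
  (D 0 u + D (pi / 2) v) +i* (D (- (pi / 2)) u + D 0 v).

Lemma regularized_cvg_Cnw G g h a t x k alpha beta : 0 < a ->
  0 <= alpha -> 0 <= beta -> alpha + beta <= k%:R ->
  (forall y, G t x y = cis (a * (y - x) ^+ 2) * g y) ->
  Cnw (k + 3) alpha g -> Cnw (k + 3) beta h ->
  regularized G h t x eps @[eps --> (0 : R)^'+] --> damped_solution a x g h.
Proof.
move=> a0 al0 be0 abk Gg Cg Ch.
have [Du Dv] := Cnw_mul_derivs_le al0 be0 abk Cg Ch.
exact: regularized_cvg a0 Gg Du Dv.
Qed.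

Lemma PsiE G g h a t x k alpha beta : 0 < a ->
  0 <= alpha -> 0 <= beta -> alpha + beta <= k%:R ->
  (forall y, G t x y = cis (a * (y - x) ^+ 2) * g y) ->
  Cnw (k + 3) alpha g -> Cnw (k + 3) beta h ->
  Psi G h t x = damped_solution a x g h.
Proof.
move=> a0 al0 be0 abk Gg Cg Ch.
apply: cvg_lim; first exact: norm_hausdorff.
exact: regularized_cvg_Cnw a0 al0 be0 abk Gg Cg Ch.
Qed.

(** The estimate behind the theorem: the constant does not depend on the
    frequency a >= a0 nor on x in a bounded set. *)
Lemma damped_solution_lipschitz k (a0 X : R) : 0 < a0 -> exists2 C : R, 0 <= C &
  forall g h1 h2 a x alpha beta, a0 <= a -> `|x| <= X ->
    0 <= alpha -> 0 <= beta -> alpha + beta <= k%:R ->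
    Cnw (k + 3) alpha g -> Cnw (k + 3) beta h1 -> Cnw (k + 3) beta h2 ->
    Normc.normc (damped_solution a x g h1 - damped_solution a x g h2 : R[i])
      <= C * (Cnw_norm (k + 3) alpha g *
              Cnw_norm (k + 3) beta (fun y => h1 y - h2 y)).
Proof.
move=> a0_gt0; have [C C0 HC] := damped_lim_lipschitz k X a0_gt0.
exists (4 * (C * 2 ^+ (k + 4))) => [|g h1 h2 a x alpha beta aa0 xX al0 be0 abk Cg C1 C2].
  by rewrite !mulr_ge0// exprn_ge0.
have [Du1 Dv1] := Cnw_mul_derivs_le al0 be0 abk Cg C1.
have [Du2 Dv2] := Cnw_mul_derivs_le al0 be0 abk Cg C2.
have [Du Dv] := Cnw_mul_derivs_le al0 be0 abk Cg (CnwB C1 C2).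
have reE : (fun y => Re (g y * (h1 y - h2 y))) =
    (fun y => Re (g y * h1 y) - Re (g y * h2 y)).
  by apply/funext => y; rewrite mulrBr raddfB.
have imE : (fun y => Im (g y * (h1 y - h2 y))) =
    (fun y => Im (g y * h1 y) - Im (g y * h2 y)).
  by apply/funext => y; rewrite mulrBr raddfB.
rewrite reE in Du; rewrite imE in Dv.
have Lu theta := HC a x theta _ _ _ _ _ aa0 xX Du1 Du2 Du.
have Lv theta := HC a x theta _ _ _ _ _ aa0 xX Dv1 Dv2 Dv.
rewrite /damped_solution (le_trans (normc_le_ReIm _))//=.
set K := C * _ in Lu Lv.
have -> : 4 * (C * 2 ^+ (k + 4)) * (Cnw_norm (k + 3) alpha g *
  Cnw_norm (k + 3) beta (fun y => h1 y - h2 y)) = K + K + (K + K).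
  by rewrite /K; ring.
have split4 (p q r s : R) : `|p + q - (r + s)| <= `|p - r| + `|q - s|.
  by rewrite (_ : _ - _ = (p - r) + (q - s)) ?ler_normD//; ring.
by rewrite lerD// (le_trans (split4 _ _ _ _))// lerD.
Qed.

(** Entourages of the complex numbers are indexed by positive elements of R[i],
    that is, by positive reals. *)
Lemma uniform_cvg_normc (U : set (R * R))
    (u : nat -> R * R -> @Cfield R) (v : R * R -> @Cfield R) (b : nat -> R) :
  (forall m p, U p -> Normc.normc (v p - u m p : R[i]) <= b m) ->
  b m @[m --> \oo] --> 0 ->
  {uniform U, u @ \oo --> v}.
Proof.
move=> ub b0 P /uniform_nbhs[E [+ EP]].
rewrite -entourage_from_ballE => -[e /= e0 eE].
have [e1 e2] : 0 < complex.Re e /\ e = (complex.Re e)%:C.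
  move: e0; rewrite ltcE /= => /andP[/eqP i0 r0]; split=> //.
  by case: e i0 {r0 eE} => p q /= ->.
have near_lt : \forall m \near \oo, b m < complex.Re e by exact: (cvgr_lt 0).
near=> m; have bm : b m < complex.Re e by near: m; exact: near_lt.
apply: EP => p Up; apply: eE; rewrite /= -ball_normE /= e2.
rewrite (_ : `|_| = (Normc.normc (v p - u m p : R[i]))%:C) // ltcR.
exact: le_lt_trans (ub m p Up) bm.
Unshelve. all: by end_near. Qed.

End Solution.

Unset Implicit Arguments.

Theorem theorem4p3 (R : realType) (T : \bar R) (V : R -> R -> R[i])
    (G : R -> R -> R -> R[i]) (alpha beta : R) (n : nat)
    (F : R -> R[i]) (F_ : nat -> R -> R[i])
    (T_gt0 : (0 < T)%E)
    (V_meas : measurable_potential T V)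
    (alpha_ge0 : 0 <= alpha)
    (n_gt : alpha + 3 < n%:R)
    (G_green : green_assumption T V alpha n G)
    (beta_ge0 : 0 <= beta)
    (beta_lt : beta < n%:R - alpha - 3)
    (F_Cnw : Cnw n beta F)
    (Fm_Cnw : forall m, Cnw n beta (F_ m))
    (Fm_cvg : Cnw_norm n beta (fun y => F y - F_ m y) @[m --> \oo] --> (0 : R)) :
  (forall H : R -> R[i], Cnw n beta H -> forall t x, time_interval T t ->
     cvg (regularized G H t x eps @[eps --> (0 : R)^'+])) /\
  (forall t x, time_interval T t ->
     exists2 U : set (R * R), nbhs ((t, x) : R * R) U &
       {uniform U, (fun m p => Psi G (F_ m) p.1 p.2) @ \oo -->
                   (fun p => Psi G F p.1 p.2)}).
Proof.
have [_ _ [a [Gt [Gt_xx [Gt_t [[ACa a_gt0 _] [Gphase [_ [CGt [[Gt_bnd _ _ _] _]]]]]]]]]] := G_green.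
have n3 : (3 <= n)%N.
  by rewrite -(ler_nat R); lra.
(* The order is written k + 3 because three orders of decay are spent: two on
   the integrable factor and one on the rate of convergence of the damping. *)
have [k nE] : exists k, n = (k + 3)%N by exists (n - 3)%N; rewrite subnK.
subst n.
have abk : alpha + beta <= k%:R by rewrite natrD in beta_lt; lra.
have CG t x : time_interval T t -> Cnw (k + 3) alpha (Gt t x).
  by move=> Tt; have [] := CGt t x Tt.
split=> [H CH t x Tt|t x Tt].
  apply: cvgP; apply: regularized_cvg_Cnw (a_gt0 t Tt) alpha_ge0 beta_ge0 abk _ (CG t x Tt) CH.
  by move=> y; exact: Gphase.
have [M HM] := Gt_bnd t x Tt.
have a2 : 0 < a t / 2 by rewrite divr_gt0// a_gt0.
have [C C0 HC] := damped_solution_lipschitz k (`|x| + 1) a2.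
(* Where the frequency stays away from 0, x is bounded and the norm of the
   amplitude is bounded, the Lipschitz constant is uniform. *)
exists [set p | [/\ time_interval T p.1, a t / 2 <= a p.1, `|p.2| <= `|x| + 1 &
    Cnw_norm (k + 3) alpha (Gt p.1 p.2) <= M]].
  have oT : open (time_interval T) by have [g [[_ oT _] _] _] := ACa.
  have n1 : \forall s \near t, time_interval T s.
    exact: open_nbhs_nbhs (conj oT Tt).
  have n2 : \forall s \near t, a t / 2 <= a s.
    have := AC_continuous ACa Tt; move/cvgr_ge; apply.
    by rewrite ltr_pdivrMr// ltr_pMr ?a_gt0// ltr1n.
  have n3' : \forall z \near x, `|z| <= `|x| + 1.
    have xz : \forall z \near x, `|x - z| <= 1 
      by apply: (@cvgr_dist_le R R _ (nbhs x) _ id x).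
    apply: filterS xz => z; rewrite distrC => xz.
    by rewrite -lerBlDl (le_trans (lerB_dist _ _)).
  have fst_near (P : set R) : (\forall s \near t, P s) ->
    \forall p \near ((t, x) : R * R), P p.1 by move=> tP; exact: cvg_fst tP.
  have snd_near (P : set R) : (\forall z \near x, P z) ->
    \forall p \near ((t, x) : R * R), P p.2 by move=> xP; exact: cvg_snd xP.
  near=> p; split; near: p.
  - exact: fst_near n1.
  - exact: fst_near n2.
  - exact: snd_near n3'.
  - exact: HM.
apply: (@uniform_cvg_normc R _ _ _
  (fun m => C * (M * Cnw_norm (k + 3) beta (fun y => F y - F_ m y)))).
  move=> m [s z] /= [Ts as_ge zX GM].
  have Gp y : G s z y = cis (a s * (y - z) ^+ 2) * Gt s z y by exact: Gphase.
  rewrite (PsiE (a_gt0 s Ts) alpha_ge0 beta_ge0 abk Gp (CG s z Ts) F_Cnw).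
  rewrite (PsiE (a_gt0 s Ts) alpha_ge0 beta_ge0 abk Gp (CG s z Ts) (Fm_Cnw m)).
  apply: (le_trans (HC _ _ _ _ _ _ _ as_ge zX alpha_ge0 beta_ge0 abk (CG s z Ts) F_Cnw (Fm_Cnw m))).
  by rewrite ler_wpM2l// ler_wpM2r// Cnw_norm_ge0.
have -> : (0 : R) = C * (M * 0) by rewrite !mulr0.
by apply: cvgMr; apply: cvgMr; exact: Fm_cvg.
Unshelve. all: by end_near. Qed.
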